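(* Let $(T,P)$ be an irreducible, transient, nearest neighbour random walk on a tree $T$ with root $o$, and let $\mu$ be a (signed) measure on $T$ with finite support. Let $\partial T$ be the Martin boundary of $(T,P)$ and $k_o$ the (extended) Martin kernel. Consider the assertions: (i) $\mu$ has the weak mean value property with respect to $o$; (ii) $\mu$ has the strong mean value property with respect to $o$; (iii) for every $\xi\in\partial T$ we have $L(k_o(\cdot,\xi),\mu)(o)=0$. Then (ii) $\Longrightarrow$ (i), and (ii) $\Longleftrightarrow$ (iii).
   Context: $T$ is a (non-oriented) tree with at most countable vertex set, also denoted $T$. $P=(p(x,y))_{x,y\in T}$ is a Markov operator: $p(x,y)\ge0$, $\sum_y p(x,y)=1$, $(Pf)(x)=\sum_y p(x,y)f(y)$ whenever $\sum_y p(x,y)|f(y)|<\infty$ for all $x$. Nearest neighbour (adapted to the tree) means that $p(x,y)>0$ if and only if $x$ and $y$ are neighbours in $T$. $f:T\to\mathbb R$ is harmonic if $Pf=f$; $\mathcal H(T,P)$ is the set of harmonic functions and $\mathcal H^\infty(T,P)$ the set of bounded ones. $Z_n$ denotes the associated Markov chain, $\Pr_x$ its law started from $x$, and $F(x,y)=\Pr_x(\exists n\ge0: Z_n=y)$ (so $F(x,x)=1$). A compactification of the discrete set $T$ is a compact Hausdorff space $\widehat T$ containing $T$ as an open, discrete, dense subset. The Martin kernel is $k_o(x,y)=F(x,y)/F(o,y)$, $x,y\in T$. The Martin compactification $\widehat T$ is the unique (up to homeomorphism) smallest compactification of the discrete set $T$ to which all functions $k_o(x,\cdot)$, $x\in T$,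 extend continuously; the extensions are again denoted $k_o(x,\cdot)$, and $\partial T=\widehat T\setminus T$ is the Martin boundary. For a signed measure $\mu$ of finite variation on the power set of $T$ and $h\in L^1(|\mu|)$, put $L(h,\mu)(x)=\int_T h\,d\mu-\mu(T)h(x)$. $\mu$ has the strong (resp. weak) mean value property with respect to $o$ if $L(h,\mu)(o)=0$ for all $h\in\mathcal H(T,P)\cap L^1(|\mu|)$ (resp. for all $h\in\mathcal H^\infty(T,P)$).
   Formalization: (ii) ⇒ (iii) is proved only when each vertex of T of infinite degree has infinitely many infinite branches (e.g. T locally finite or without leaves); it is false for general countable trees. (ii) ⇒ (i) and (iii) ⇒ (ii) are proved in full. *)

(* Defs.v *)
From HB Require Import structures.
From mathcomp Require Import all_boot all_order all_algebra.
From mathcomp Require Import all_classical all_reals all_analysis.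

Set Implicit Arguments.
Unset Strict Implicit.
Unset Printing Implicit Defensive.

Import Order.TTheory GRing.Theory Num.Theory.
Import numFieldNormedType.Exports.

Local Open Scope classical_set_scope.
Local Open Scope ring_scope.

(* A possibly infinite simple graph on T is its adjacency relation e.  A cycle
   of size 2 for e is an edge run back and forth, hence the bound on size. *)
Record is_tree (T : choiceType) (e : rel T) : Prop := IsTree {
  tree_sym : symmetric e;
  tree_irr : irreflexive e;
  tree_connected : forall x y : T, exists2 q : seq T, path e x q & last x q = y;
  tree_acyclic : forall c : seq T, cycle e c -> uniq c -> (size c <= 2)%N }.

(* The branch at the neighbour y of x: the connected component of y in the
   tree deprived of x. *)
Definition branch (T : choiceType) (e : rel T) (x y : T) : set T :=
  [set z | exists q : seq T, [/\ path e y q, last y q = z & x \notin y :: q]].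

(* Holds if the tree is locally finite, and also if it has no leaves.

   The role of this condition: if x has infinite degree, the neighbours of x
   accumulate at boundary points whose Martin kernel coincides with the one of
   the vertex x, hence is not harmonic.  If moreover all but finitely many
   branches at x are finite, harmonic functions do not control these points.
   Indeed a harmonic h is constant on x and the finite branches at x, so that,
   for y_1, ..., y_m the neighbours of x with an infinite branch,
     p(x,y_1) (h(y_1) - h(x)) + ... + p(x,y_m) (h(y_m) - h(x)) = 0.
   This is a strong mean value property, with respect to any vertex, of a
   finitely supported measure of total mass 0; the Martin kernel of x violates
   it by transience. *)
Definition infinitely_branching (T : choiceType) (e : rel T) : Prop :=
  forall x : T, infinite_set [set y | e x y] ->
    infinite_set [set y | e x y /\ infinite_set (branch e x y)].

Record is_markov_operator (R : realType) (T : choiceType) (p : T -> T -> R) :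
    Prop := IsMarkovOperator {
  markov_ge0 : forall x y : T, 0 <= p x y;
  markov_sum1 : forall x : T, (\esum_(y in [set: T]) (p x y)%:E = 1)%E }.

Definition nearest_neighbour (R : realType) (T : choiceType) (e : rel T)
    (p : T -> T -> R) : Prop :=
  forall x y : T, (0 < p x y) <-> e x y.

(* The sum of an absolutely summable family of reals. *)
Definition real_sum (R : realType) (T : choiceType) (a : T -> R) : \bar R :=
  (\esum_(y in [set: T]) (EFin \o a)^\+ y
   - \esum_(y in [set: T]) (EFin \o a)^\- y)%E.

Definition harmonic_fun (R : realType) (T : choiceType) (p : T -> T -> R)
    (f : T -> R) : Prop :=
  (forall x : T, summable [set: T] (fun y => (p x y * f y)%:E)) /\
  (forall x : T, real_sum (fun y => p x y * f y) = (f x)%:E).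

Definition bounded_real_fun (R : realType) (T : choiceType) (f : T -> R) :
    Prop :=
  exists M : R, forall x : T, `|f x| <= M.

(* Z, under the law Pr x, is the Markov chain with transition probabilities p
   started from x. *)
Definition is_markov_chain (R : realType) (d : measure_display)
    (T : measurableType d) (d' : measure_display) (Omega : measurableType d')
    (p : T -> T -> R) (Pr : T -> probability Omega R)
    (Z : nat -> {mfun Omega >-> T}) : Prop :=
  forall (x : T) (n : nat) (z : nat -> T),
    Pr x (\bigcap_(k in [set k | (k <= n)%N]) (Z k @^-1` [set z k])) =
    ((z 0%N == x)%:R * \prod_(0 <= k < n) p (z k) (z k.+1))%:E.

Definition irreducible_chain (R : realType) (d : measure_display)
    (T : measurableType d) (d' : measure_display) (Omega : measurableType d')
    (Pr : T -> probability Omega R) (Z : nat -> {mfun Omega >-> T}) : Prop :=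
  forall x y : T, exists n : nat, (0 < Pr x (Z n @^-1` [set y]))%E.

Definition transient_chain (R : realType) (d : measure_display)
    (T : measurableType d) (d' : measure_display) (Omega : measurableType d')
    (Pr : T -> probability Omega R) (Z : nat -> {mfun Omega >-> T}) : Prop :=
  forall x : T,
    (Pr x (\bigcup_(n in [set n | (0 < n)%N]) (Z n @^-1` [set x])) < 1)%E.

Definition hitting_prob (R : realType) (d : measure_display)
    (T : measurableType d) (d' : measure_display) (Omega : measurableType d')
    (Pr : T -> probability Omega R) (Z : nat -> {mfun Omega >-> T})
    (x y : T) : R :=
  fine (Pr x (\bigcup_n (Z n @^-1` [set y]))).

Definition martin_kernel (R : realType) (d : measure_display)
    (T : measurableType d) (d' : measure_display) (Omega : measurableType d')
    (Pr : T -> probability Omega R) (Z : nat -> {mfun Omega >-> T})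
    (o x y : T) : R :=
  hitting_prob Pr Z x y / hitting_prob Pr Z o y.

(* The third field says that i is an open embedding of the discrete space T. *)
Record is_compactification (T : choiceType) (That : topologicalType)
    (i : T -> That) : Prop := IsCompactification {
  cptn_compact : compact [set: That];
  cptn_hausdorff : hausdorff_space That;
  cptn_open : forall A : set T, open (i @` A);
  cptn_inj : injective i;
  cptn_dense : dense (range i) }.

Definition extends_kernel (R : realType) (T : choiceType) (k : T -> T -> R)
    (That : topologicalType) (i : T -> That) (K : T -> That -> R) : Prop :=
  forall x : T, continuous (K x) /\ (forall y : T, K x (i y) = k x y).

Record is_martin_compactification (R : realType) (T : choiceType)
    (k : T -> T -> R) (That : topologicalType) (i : T -> That) : Prop :=
    IsMartinCompactification {
  martin_cptn : is_compactification i;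
  martin_extends : exists K : T -> That -> R, extends_kernel k i K;
  martin_smallest : forall (S : topologicalType) (j : T -> S),
    is_compactification j ->
    (exists K : T -> S -> R, extends_kernel k j K) ->
    exists2 phi : S -> That, continuous phi & forall x : T, phi (j x) = i x }.

Definition hahn_pair (R : realType) (d : measure_display)
    (T : measurableType d) (mu : {charge set T -> \bar R}) :
    {PN : set T * set T | hahn_decomposition mu PN.1 PN.2} :=
  let: exist P exN := cid (Hahn_decomposition mu) in
  let: exist N hPN := cid exN in
  exist (fun PN : set T * set T => hahn_decomposition mu PN.1 PN.2) (P, N) hPN.

Definition total_variation (R : realType) (d : measure_display)
    (T : measurableType d) (mu : {charge set T -> \bar R}) :
    {measure set T -> \bar R} :=
  charge_variation (svalP (hahn_pair mu)).

Definition charge_integral (R : realType) (d : measure_display)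
    (T : measurableType d) (mu : {charge set T -> \bar R}) (h : T -> R) :
    \bar R :=
  (\int[jordan_pos (svalP (hahn_pair mu))]_x (h x)%:E
   - \int[jordan_neg (svalP (hahn_pair mu))]_x (h x)%:E)%E.

Definition finitely_supported (R : realType) (d : measure_display)
    (T : measurableType d) (mu : {charge set T -> \bar R}) : Prop :=
  exists2 A : set T, finite_set A & forall B : set T, A `&` B = set0 -> mu B = 0%E.

Definition mv_defect (R : realType) (d : measure_display)
    (T : measurableType d) (h : T -> R) (mu : {charge set T -> \bar R})
    (x : T) : \bar R :=
  (charge_integral mu h - mu [set: T] * (h x)%:E)%E.

Definition strong_mean_value (R : realType) (d : measure_display)
    (T : measurableType d) (p : T -> T -> R) (mu : {charge set T -> \bar R})
    (o : T) : Prop :=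
  forall h : T -> R, harmonic_fun p h ->
    (total_variation mu).-integrable [set: T] (EFin \o h) ->
    mv_defect h mu o = 0%E.

Definition weak_mean_value (R : realType) (d : measure_display)
    (T : measurableType d) (p : T -> T -> R) (mu : {charge set T -> \bar R})
    (o : T) : Prop :=
  forall h : T -> R, harmonic_fun p h -> bounded_real_fun h ->
    mv_defect h mu o = 0%E.

(* Main.v *)
Require Import Defs.
From HB Require Import structures.
From mathcomp Require Import all_boot all_order all_algebra.
From mathcomp Require Import all_classical all_reals all_analysis.

Import Order.TTheory GRing.Theory Num.Theory.
Import numFieldNormedType.Exports.

Local Open Scope classical_set_scope.
Local Open Scope ring_scope.

Set Implicit Arguments.
Unset Strict Implicit.
Unset Printing Implicit Defensive.

(** Let F(x,y) be the probability to hit y from x, and write the measure as the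
    sum of m_a delta_a over a finite set of vertices.  The mean value property
    for h says that L(h) = sum m_a (h(a) - h(o)) vanishes.  Hang the tree from
    o, let S be a finite subtree containing o and the support of the measure,
    and retract the tree onto S; the fibre of v in S consists of v and of the
    branches hanging from v outside S.  A walk can enter or leave a fibre only
    through its vertex in S, so F is multiplicative there ([hit_cut]), and on S
    the Martin kernel at z is the one at the retraction of z ([kernel_fibre]):
    a point at infinity matters only through the fibre in which it lies.

    The points at infinity lie in the infinite fibres.  By compactness each
    infinite fibre accumulates at a boundary point, whose kernel is k_o(.,v) on
    S ([boundary_accumulation]); conversely a boundary point is in the closure
    of some infinite fibre ([boundary_fibre]).  The boundary condition
    therefore reads: L(k_o(.,v)) = 0 for every v in S with an infinite fibre.

    From the boundary to harmonic functions: on S, a harmonic h is a linear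
    combination of the functions F(.,v), where v has an infinite fibre
    ([harmonic_hit_expansion]).  Indeed, collapsing the excursions outside S
    gives a Laplacian on S ([reduced_laplacian]), whose inverse is F up to the
    positive factors 1 - U(v), U(v) < 1 being the return probability; and the
    collapsed Laplacian of h vanishes at the vertices with a finite fibre, since
    by the maximum principle h and F(.,v) are constant on a finite fibre.

    From harmonic functions to the boundary: if the tree is infinitely
    branching, an infinite fibre contains a ray ([ray_in_fibre]), and along a
    ray the kernels stabilise at each vertex to a harmonic function
    ([ray_kernel_harmonic]), which is k_o(.,v) on S.

    Every function is integrable for a finitely supported measure, so the
    strong property contains the weak one. *)

(** * Rooted trees *)

(** [dep] is the distance to the root up to a constant, which is enough for
    inductions and for the comparison of levels. *)
Record is_rooted (T : choiceType) (e : rel T) (o : T) (par : T -> T)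
    (dep : T -> nat) : Prop := IsRooted {
  rooted_root : par o = o;
  rooted_edge : forall x, x != o -> e x (par x);
  rooted_dep : forall x, x != o -> dep x = (dep (par x)).+1;
  rooted_par : forall x y, e x y ->
    (y != o /\ x = par y) \/ (x != o /\ y = par x) }.

(** Removing an edge of a tree disconnects its ends: a path between them, made
    simple, would close up to a cycle through that edge. *)
Lemma tree_bridge (T : choiceType) (e : rel T) (x y : T) (q : seq T) :
  is_tree e -> e x y ->
  path (fun u v => [&& e u v, (u, v) != (x, y) & (u, v) != (y, x)]) x q ->
  last x q != y.
Proof.
move=> tree_e exy pq; apply/eqP => lq.
case/shortenP: pq lq => q' pq' uq' _ lq'.
have pe : path e x q' by apply: sub_path pq' => u v /and3P[].
have cyc : cycle e (x :: q').
  by rewrite /= rcons_path pe lq' (tree_sym tree_e).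
have := tree_acyclic tree_e cyc uq'.
case: q' pq' uq' lq' {pe cyc} => [_ _ /= xy _|z [|//] /= + _ zy _].
  by move: exy; rewrite xy (tree_irr tree_e).
by rewrite zy eqxx /= andbF.
Qed.

Lemma tree_distance (T : choiceType) (e : rel T) (o : T) : is_tree e ->
  exists dep : T -> nat,
    forall x, x != o -> exists y, e x y /\ dep x = (dep y).+1.
Proof.
move=> tree_e.
pose P x n := `[< exists q, [/\ path e o q, last o q = x & size q = n] >].
have exP x : exists n, P x n.
  have [q pq lq] := tree_connected tree_e o x.
  by exists (size q); apply/asboolP; exists q.
exists (fun x => ex_minn (exP x)) => x xo.
case: ex_minnP => n /asboolP[q [pq lq <-]] minx.
case: (lastP q) => [|q' z] in pq lq minx *.
  by move: xo; rewrite -lq eqxx.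
move: pq lq; rewrite rcons_path last_rcons => /andP[pq' ez] zx.
rewrite {z}zx in ez minx *; exists (last o q'); split.
  by rewrite (tree_sym tree_e).
case: ex_minnP => m /asboolP[r [pr lr <-]] miny.
rewrite size_rcons; congr _.+1; apply/eqP; rewrite eqn_leq; apply/andP; split.
  rewrite -ltnS -(size_rcons r x) -(size_rcons q' x); apply: minx.
  apply/asboolP; exists (rcons r x).
  by rewrite rcons_path pr lr ez last_rcons.
by apply: miny; apply/asboolP; exists q'.
Qed.

(** Any tree can be hung from any vertex.  An edge that did not join a vertex to
    its parent could be bypassed through the root, against [tree_bridge]. *)
Lemma tree_rooted (T : choiceType) (e : rel T) (o : T) : is_tree e ->
  exists par dep, is_rooted e o par dep.
Proof.
move=> tree_e; have [dep depP] := tree_distance o tree_e.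
have /choice[par parP] : forall x, exists y,
    (x == o /\ y = o) \/ [/\ x != o, e x y & dep x = (dep y).+1].
  move=> x; have [->|xo] := eqVneq x o; first by exists o; left.
  by have [y [exy dxy]] := depP x xo; exists y; right.
have paro : par o = o by have [[]//|[]] := parP o; rewrite eqxx.
have parE x : x != o -> e x (par x) /\ dep x = (dep (par x)).+1.
  by move=> xo; have [[]|[]//] := parP x; rewrite (negbTE xo).
exists par, dep; split=> // [x /parE[]//|x /parE[]//|x y exy].
apply: contrapT => /not_orP[nxy nyx].
pose e' := fun u v => [&& e u v, (u, v) != (x, y) & (u, v) != (y, x)].
have to_root z : exists2 q, path e' z q & last z q = o.
  have [n] := ubnP (dep z); elim: n z => // n IHn z.
  have [->|zo] := eqVneq z o; first by exists [::].
  have [ez ->] := parE z zo; rewrite ltnS => /IHn[q pq lq].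
  exists (par z :: q) => //=; rewrite pq andbT /e' ez /=.
  apply/andP; split; apply/eqP => -[zE pzE].
    by apply: nyx; rewrite -zE.
  by apply: nxy; rewrite -zE.
have e'_sym u v : e' u v = e' v u.
  by rewrite /e' (tree_sym tree_e) !xpair_eqE; congr (_ && _);
     rewrite andbC; congr (~~ _ && ~~ _); rewrite andbC.
have [q pq lq] := to_root x; have [r pr lr] := to_root y.
have := @tree_bridge _ _ x y (q ++ rev (belast y r)) tree_e exy.
rewrite -/e' cat_path pq last_cat lq -{1}lr rev_path /= => bridge.
have : path (fun z => e'^~ z) y r by rewrite (eq_path (e' := e')).
move/bridge; case: r pr lr {bridge} => [_ /= ->|z r _ _ /=].
  by rewrite eqxx.
by rewrite rev_cons last_rcons eqxx.
Qed.

Section Rooted.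
Context {T : choiceType} {e : rel T} {o : T} {par : T -> T} {dep : T -> nat}.
Hypothesis rooted : is_rooted e o par dep.

Definition descendants (x : T) : set T := [set z | exists k, iter k par z = x].

Lemma descendants_refl x : descendants x x.
Proof. by exists 0%N. Qed.

Lemma descendants_par x z : descendants x (par z) -> descendants x z.
Proof. by case=> k zx; exists k.+1; rewrite iterSr. Qed.

Lemma par_descendants x z : descendants x z -> z = x \/ descendants x (par z).
Proof. by case=> -[|k] zx; [left|right; exists k; rewrite -iterSr]. Qed.

Lemma dep_par_le z : (dep (par z) <= dep z)%N.
Proof.
have [->|zo] := eqVneq z o; first by rewrite (rooted_root rooted).
by rewrite (rooted_dep rooted zo).
Qed.

Lemma dep_descendants x z : descendants x z -> (dep x <= dep z)%N.
Proof.
case=> k <-; elim: k => //= k; apply: leq_trans; exact: dep_par_le.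
Qed.

Lemma dep_edge x y : e x y -> (dep y <= (dep x).+1)%N.
Proof.
case/(rooted_par rooted) => -[xo ->]; first by rewrite (rooted_dep rooted xo).
by rewrite (leq_trans (dep_par_le x)).
Qed.

(** A vertex separates its descendants from the rest of the tree; this is the
    form in which [hit_cut] uses it. *)
Lemma descendants_edge x y z :
  e y z -> ~ descendants x y -> descendants x z -> z = x.
Proof.
case/(rooted_par rooted) => -[_ ->] nx xz.
  by have [//|/nx] := par_descendants xz.
by case: nx; exact: descendants_par.
Qed.

Lemma root_descendants x : descendants x o -> x = o.
Proof. by case=> k <-; elim: k => //= k ->; rewrite (rooted_root rooted). Qed.

(** ** Finite subtrees containing the root and the retraction onto them *)

Definition ancestor_closed (S : seq T) : Prop :=
  o \in S /\ {homo par : x / x \in S}.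

Lemma ancestor_closed_hull (A : seq T) :
  exists2 S : seq T, uniq S & ancestor_closed S /\ {subset A <= S}.
Proof.
suff [S [[oS parS] AS]] : exists S, ancestor_closed S /\ {subset A <= S}.
  exists (undup S); first exact: undup_uniq.
  split=> [|x /AS]; last by rewrite mem_undup.
  by split=> [|x]; rewrite !mem_undup //; exact: parS.
have chain a : exists2 S, ancestor_closed S & a \in S.
  have [n] := ubnP (dep a); elim: n a => // n IHn a.
  have [->|ao] := eqVneq a o.
    exists [:: o]; rewrite ?mem_head //; split; rewrite ?mem_head // => x.
    by rewrite !inE => /eqP->; rewrite (rooted_root rooted).
  rewrite (rooted_dep rooted ao) ltnS => /IHn[S [oS parS] aS].
  exists (a :: S); last exact: mem_head.
  split=> [|x]; rewrite !inE ?oS ?orbT // => /predU1P[->|/parS->].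
    by rewrite aS orbT.
  by rewrite orbT.
elim: A => [|a A [S [[oS parS] AS]]].
  by have [S clS _] := chain o; exists S.
have [S' [oS' parS'] aS'] := chain a; exists (S' ++ S); split.
  split=> [|x]; first by rewrite mem_cat oS'.
  by rewrite !mem_cat => /orP[/parS'->|/parS->]; rewrite ?orbT.
by move=> x /predU1P[->|/AS]; rewrite mem_cat ?aS' // => ->; rewrite orbT.
Qed.

(** The third field makes the retraction constant on each component of the
    complement of S, and equal there to the vertex of S where it hangs. *)
Record is_retraction (S : seq T) (proj : T -> T) : Prop := IsRetraction {
  retraction_in : forall z, proj z \in S;
  retraction_id : forall z, z \in S -> proj z = z;
  retraction_edge : forall x y, e x y -> x \notin S -> proj x = proj y }.

(** Send a vertex to its nearest ancestor in S. *)
Lemma ancestor_retraction (S : seq T) : ancestor_closed S ->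
  exists proj, is_retraction S proj.
Proof.
move=> [oS parS].
have exk z : exists k, iter k par z \in S.
  have [n] := ubnP (dep z); elim: n z => // n IHn z.
  have [->|zo] := eqVneq z o; first by exists 0%N.
  rewrite (rooted_dep rooted zo) ltnS => /IHn[k kS].
  by exists k.+1; rewrite iterSr.
pose proj z := iter (ex_minn (exk z)) par z.
have projN z : z \notin S -> proj z = proj (par z).
  move=> zS; rewrite /proj; case: ex_minnP => -[|m] mS minm.
    by rewrite /= mS in zS.
  case: ex_minnP => k kS mink; rewrite iterSr; congr (iter _ _ _).
  apply/eqP; rewrite eqn_leq mink -?iterSr // andbT -ltnS.
  by apply: minm; rewrite iterSr.
exists proj; split=> [z|z zS|x y exy xS]; rewrite /proj.
- by case: ex_minnP.
- by case: ex_minnP => -[//|m] _ /(_ 0%N zS).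
- rewrite -!/(proj _); have [[_ xE]|[_ ->]] := rooted_par rooted exy.
    by rewrite xE [RHS]projN //; apply: contra xS => /parS; rewrite -xE.
  exact: projN.
Qed.

Lemma retraction_fibreP (S : seq T) (proj : T -> T) (v z : T) :
  ancestor_closed S -> is_retraction S proj -> proj z = v ->
  z = v \/ exists y, [/\ y != o, par y = v, y \notin S & descendants y z].
Proof.
move=> [oS parS] projP; have [n] := ubnP (dep z); elim: n z => // n IHn z.
have [zS _ <-|zS] := boolP (z \in S).
  by left; rewrite (retraction_id projP).
have zo : z != o by apply: contraNneq zS => ->.
rewrite (rooted_dep rooted zo) ltnS => /IHn{}IHn.
rewrite (retraction_edge projP (rooted_edge rooted zo) zS) => /IHn[pz|].
  by right; exists z; split=> //; exact: descendants_refl.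
by case=> y [yo py yS yz]; right; exists y; split=> //; exact: descendants_par.
Qed.

(** ** Descending rays *)

Hypothesis tree_e : is_tree e.

Lemma branch_descendants x y : y != o -> par y = x ->
  branch e x y `<=` descendants y.
Proof.
move=> yo pyx z [q [pq <- xq]].
have := descendants_refl y; move: {1 2 4 6}y pq xq => w.
elim: q w => [//|w' q IHq] w /=.
move=> /andP[eww' pq]; rewrite !inE !negb_or => /and3P[xw xw' xq] yw.
apply: IHq => //; first by rewrite inE negb_or xw' xq.
have [[_ wE]|[_ wE]] := rooted_par rooted eww'.
  by apply: descendants_par; rewrite -wE.
have [wy|] := par_descendants yw; last by rewrite wE.
by case/eqP: xw'; rewrite wE wy.
Qed.

(** If x has finite degree, the pigeonhole principle gives an infinite branch
    among finitely many; otherwise infinite branching provides infinitely many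
    of them, and only finitely many are excluded by S or contain the root. *)
Lemma infinite_child (x : T) (S : seq T) : infinitely_branching e ->
  infinite_set ([set x] `|`
    \bigcup_(y in [set y | [/\ y != o, par y = x & y \notin S]])
      descendants y) ->
  exists y, [/\ y != o, par y = x, y \notin S & infinite_set (descendants y)].
Proof.
move=> brT infD; have [finx|infx] := pselect (finite_set [set y | e x y]).
  apply: contrapT => nex; apply: infD; rewrite finite_setU; split=> //.
  apply: bigcup_finite => [|y [yo pyx yS]].
    apply: sub_finite_set finx => y [yo <- _] /=.
    by rewrite (tree_sym tree_e); exact: (rooted_edge rooted yo).
  by apply: contrapT => infy; apply: nex; exists y.
have := brT x infx; set X := [set y | _] => infX.
have [y [[exy infy] yS]] : X `\` [set` par x :: S] !=set0.
  apply/set0P/negP => /eqP; rewrite setD_eq0 => XS.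
  by apply: infX; apply: sub_finite_set XS _; exact: finite_seq.
move: yS => /= /negP; rewrite inE negb_or => /andP[/eqP ypx yS].
have [[yo xE]|[_ //]] := rooted_par rooted exy.
exists y; split=> // finy; apply: infy; apply: sub_finite_set finy.
exact: branch_descendants.
Qed.

(** Leave S through an infinite branch at v, then keep choosing children with
    infinitely many descendants. *)
Lemma ray_in_fibre (S : seq T) (proj : T -> T) (v : T) :
  infinitely_branching e -> ancestor_closed S -> is_retraction S proj ->
  v \in S -> infinite_set (proj @^-1` [set v]) ->
  exists r : nat -> T,
    [/\ forall n, r n != o, forall n, par (r n.+1) = r n
      & forall n, proj (r n) = v].
Proof.
move=> brT clS projP vS infv; have [oS parS] := clS.
have [y0 [y0o py0 y0S infy0]] : exists y,
    [/\ y != o, par y = v, y \notin S & infinite_set (descendants y)].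
  apply: infinite_child => //; apply: sub_infinite_set infv => z /= pz.
  have [->|[y [yo py yS yz]]] := retraction_fibreP clS projP pz; first by left.
  by right; exists y.
have /choice[f fP] : forall x, exists y, infinite_set (descendants x) ->
    [/\ y != o, par y = x & infinite_set (descendants y)].
  move=> x; have [infx|finx] := pselect (infinite_set (descendants x));
    last by exists x.
  have [|y [yo py _ infy]] := @infinite_child x [::] brT; last by exists y.
  apply: sub_infinite_set infx => z xz.
  have [n] := ubnP (dep z); elim: n z xz => // n IHn z xz zn.
  have [->|xpz] := par_descendants xz; first by left.
  have [zo|zo] := eqVneq z o.
    by left; move: xz; rewrite zo => /root_descendants.
  move: zn; rewrite (rooted_dep rooted zo) ltnS => /(IHn _ xpz)[pzx|].
    by right; exists z; [split|exact: descendants_refl].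
  by case=> y yP yz; right; exists y => //; exact: descendants_par.
pose r n := iter n f y0.
have infr n : infinite_set (descendants (r n)).
  by elim: n => [//|n /fP[]].
have ro n : r n != o by case: n => [//|n]; have [] := fP _ (infr n).
have pr n : par (r n.+1) = r n by have [] := fP _ (infr n).
exists r; split=> // n; suff [] : r n \notin S /\ proj (r n) = v by [].
elim: n => [|n [rS rv]].
  split=> //; rewrite (retraction_edge projP (rooted_edge rooted y0o)) //.
  by rewrite py0 (retraction_id projP).
have rS' : r n.+1 \notin S by apply: contra rS; rewrite -(pr n); exact: parS.
split=> //.
by rewrite (retraction_edge projP (rooted_edge rooted (ro n.+1))) // pr.
Qed.

End Rooted.

Arguments descendants {T} par x.
Arguments ancestor_closed {T} o par S.
Arguments is_retraction {T} e S proj.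

(** * Unordered sums and the law of the chain *)

Section UnorderedSums.
Local Open Scope ereal_scope.

Lemma esumZ (R : realType) (T : choiceType) (c : R) (a : T -> \bar R) :
  (0 <= c)%R -> (forall x, 0 <= a x) ->
  \esum_(x in [set: T]) (c%:E * a x) = c%:E * \esum_(x in [set: T]) a x.
Proof.
move=> c0 a0; rewrite /esum -ereal_supZl //; last first.
  by apply/set0P; exists (\sum_(x \in set0) a x), set0 => //; exact: fsets_set0.
congr ereal_sup; apply/seteqP; split => [_ [X fX <-]|_ [_ [X fX <-] <-]].
  by exists (\sum_(x \in X) a x); [exists X|rewrite ge0_mule_fsumr].
by exists X => //; rewrite ge0_mule_fsumr.
Qed.

Lemma measure_fibres (R : realType) (T : choiceType) (d' : measure_display)
    (Omega : measurableType d') (m : {measure set Omega -> \bar R})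
    (f : Omega -> T) (A : set Omega) :
  countable [set: T] -> measurable A ->
  (forall w, measurable (f @^-1` [set w])) ->
  m A = \esum_(w in [set: T]) m (A `&` f @^-1` [set w]).
Proof.
move=> /countable_injP[g g_inj] mA mf.
have g_injT w w' : g w = g w' -> w = w' by move=> /g_inj; apply; rewrite inE.
pose B n := A `&` [set om | g (f om) = n].
have BgE w : B (g w) = A `&` f @^-1` [set w].
  apply/seteqP; split => om [Aom] /= fom; split; rewrite //= ?fom //.
  exact: g_injT.
have B0 n : ~ range g n -> B n = set0.
  move=> ngn; apply/seteqP; split => // om [_ /= gn].
  by case: ngn; exists (f om).
have mB n : measurable (B n).
  have [[w _ <-]|/B0->] := pselect (range g n); last exact: measurable0.
  by rewrite BgE; exact: measurableI.
have AE : A = \bigcup_(n in [set: nat]) B n.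
  apply/seteqP; split => [om Aom|om [n _ []//]].
  by exists (g (f om)).
rewrite [in LHS]AE measure_bigcup //; last first.
  apply/trivIsetP => n k _ _ /eqP nk; apply/seteqP.
  by split => // om [[_ nE] [_ kE]]; apply: nk; rewrite -nE -kE.
rewrite nneseries_esum // (_ : [set x | _] = [set: nat]); last first.
  by apply/seteqP; split => // n _ /=; rewrite inE.
rewrite [RHS](eq_esum (b := fun w => m (B (g w)))); last first.
  by move=> w _; rewrite BgE.
rewrite -(esum_image [set: T] g (fun n => m (B n))); last first.
  by move=> x y _ _; exact: g_injT.
rewrite [RHS]esum_mkcond; apply: eq_esum => n _; case: ifPn => // /negP.
by rewrite inE => /B0->; rewrite measure0.
Qed.

End UnorderedSums.

Section Chain.
Local Open Scope ereal_scope.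
Context {R : realType} {d : measure_display} {T : measurableType d}.
Context {d' : measure_display} {Omega : measurableType d'}.
Context {p : T -> T -> R} {Pr : T -> probability Omega R}.
Context {Z : nat -> {mfun Omega >-> T}}.
Hypothesis countable_T : countable [set: T].
Hypothesis powerset_T : forall A : set T, measurable A.
Hypothesis markov_p : is_markov_operator p.
Hypothesis chain_Z : is_markov_chain p Pr Z.

Lemma measurable_visit n (A : set T) : measurable (Z n @^-1` A).
Proof. by rewrite -[X in measurable X]setTI; exact: measurable_funP. Qed.
Hint Resolve measurable_visit : core.

Definition visit_from (m : nat) (y : T) : set Omega :=
  \bigcup_(k in [set k | (m <= k)%N]) Z k @^-1` [set y].

Definition visit_between (m n : nat) (y : T) : set Omega :=
  \bigcup_(k in [set k | (m <= k <= m + n)%N]) Z k @^-1` [set y].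

Definition trajectory (m : nat) (z : nat -> T) : set Omega :=
  \bigcap_(k in [set k | (k <= m)%N]) (Z k @^-1` [set z k]).

Lemma measurable_visit_from m y : measurable (visit_from m y).
Proof. by apply: bigcup_measurable. Qed.

Lemma measurable_visit_between m n y : measurable (visit_between m n y).
Proof. by apply: bigcup_measurable. Qed.

Lemma measurable_trajectory m z : measurable (trajectory m z).
Proof. by apply: bigcap_measurable => //; exists 0%N. Qed.

(** These approximations of the hitting probability are defined without the
    chain, so that bounds on them follow by induction on n. *)
Fixpoint hit_within (n : nat) (x y : T) : \bar R :=
  if x == y then 1 else
  if n is n'.+1 then \esum_(w in [set: T]) ((p x w)%:E * hit_within n' w y)
  else 0.

Lemma hit_within_ge0 n x y : 0 <= hit_within n x y.
Proof.
elim: n x => [|n IHn] x /=; case: ifP => // _.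
by apply: esum_ge0 => w _; rewrite mule_ge0 // lee_fin (markov_ge0 markov_p).
Qed.

Lemma hit_within_self n x : hit_within n x x = 1.
Proof. by case: n => [|n] /=; rewrite eqxx. Qed.

(** The Markov property, for visits to y.  The law of the chain being given on
    finite trajectories, conditioning means here to fix the past trajectory;
    the induction on n splits the event along the position at time m + 1. *)
Lemma trajectory_visit_between x y m n z :
  Pr x (trajectory m z `&` visit_between m n y) =
  ((z 0%N == x)%:R * \prod_(0 <= k < m) p (z k) (z k.+1))%:E
  * hit_within n (z m) y.
Proof.
rewrite -chain_Z -/(trajectory m z).
have now m' n' z' : z' m' = y ->
    trajectory m' z' `&` visit_between m' n' y = trajectory m' z'.
  move=> zy; apply/seteqP; split => [om []//|om omz]; split => //.
  exists m'; first by rewrite /= leqnn leq_addr.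
  by rewrite -zy; exact: (omz m' (leqnn _)).
elim: n m z => [|n IHn] m z; have [zy|zy] := eqVneq (z m) y.
- by rewrite now // zy hit_within_self mule1.
- rewrite /= (negbTE zy) mule0 -[RHS](@measure0 _ _ _ (Pr x)); congr (Pr x _).
  apply/seteqP; split => // om [omz [k /=]].
  rewrite addn0 -eqn_leq => /eqP <- omy.
  by case/eqP: zy; rewrite -omy; apply/esym; exact: (omz m (leqnn _)).
- by rewrite now // zy hit_within_self mule1.
have stepE : trajectory m z `&` visit_between m n.+1 y =
    trajectory m z `&` visit_between m.+1 n y.
  apply/seteqP; split => om [omz [k /= /andP[mk kmn] omy]]; split => //.
    exists k => //=; rewrite addSnnS kmn andbT ltn_neqAle mk andbT.
    apply: contraNneq zy => mE; rewrite -omy -mE.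
    by apply/eqP/esym; exact: (omz m (leqnn _)).
  by exists k => //=; rewrite addnS -addSn kmn ltnW.
have mstep : measurable (trajectory m z `&` visit_between m.+1 n y).
  by apply: measurableI; [exact: measurable_trajectory
                         |exact: measurable_visit_between].
rewrite stepE (@measure_fibres _ _ _ _ (Pr x) (Z m.+1) _ countable_T mstep) //=.
rewrite (negbTE zy) [in RHS]chain_Z -esumZ; last first.
- move=> w; rewrite mule_ge0 ?hit_within_ge0 // lee_fin.
  exact: (markov_ge0 markov_p).
- by rewrite mulr_ge0 // prodr_ge0 // => k _; rewrite (markov_ge0 markov_p).
apply: eq_esum => w _; pose z' k := if (k == m.+1)%N then w else z k.
have z'E k : (k <= m)%N -> z' k = z k.
  by move=> km; rewrite /z' ltn_eqF.
have -> : trajectory m z `&` visit_between m.+1 n y `&` Z m.+1 @^-1` [set w] =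
    trajectory m.+1 z' `&` visit_between m.+1 n y.
  apply/seteqP; split => om.
    move=> [[omz omy] omw]; split => // k /=.
    rewrite leq_eqVlt => /predU1P[->|km].
      by rewrite /= /z' eqxx.
    by rewrite /= z'E //; exact: (omz k km).
  move=> [omz omy]; split; last first.
    by have := omz m.+1 (leqnn _); rewrite /= /z' eqxx.
  by split => // k /= km; rewrite -z'E //; exact: (omz k (leqW km)).
rewrite IHn chain_Z muleA -EFinM; congr (_%:E * hit_within _ _ _).
  rewrite big_nat_recr //= mulrA z'E // (z'E m) //; congr (_ * _ * p _ _)%R.
    by apply: eq_big_nat => k /andP[_ km]; rewrite !z'E // ltnW.
  by rewrite /z' eqxx.
by rewrite /z' eqxx.
Qed.

Lemma trajectory0 z : trajectory 0 z = Z 0%N @^-1` [set z 0%N].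
Proof.
apply/seteqP; split => om /=; first by move=> /(_ 0%N (leqnn _)).
by move=> omz k; rewrite /= leqn0 => /eqP->.
Qed.

Lemma start_event x (A : set Omega) : measurable A ->
  Pr x A = Pr x (Z 0%N @^-1` [set x] `&` A).
Proof.
move=> mA; rewrite (@measure_fibres _ _ _ _ (Pr x) (Z 0%N) _ countable_T mA) //.
rewrite setIC (esumID [set x]) //= setTI esum_set1 // esum1 ?adde0 //=.
move=> w [_ wx].
apply/eqP; rewrite eq_le measure_ge0 andbT.
have : Pr x (Z 0%N @^-1` [set w]) = 0.
  rewrite -(trajectory0 (fun=> w)) chain_Z big_nil mulr1.
  by case: eqVneq wx => // ->.
by move=> <-; rewrite le_measure ?inE //; exact: measurableI.
Qed.

Lemma visit_from_cvg x (B : set Omega) m y : measurable B ->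
  Pr x (B `&` visit_between m n y) @[n --> \oo] --> Pr x (B `&` visit_from m y).
Proof.
move=> mB.
have -> : B `&` visit_from m y = \bigcup_n (B `&` visit_between m n y).
  apply/seteqP; split => om.
    by case=> Bom [k /= mk omy]; exists (k - m)%N => //; split=> //;
       exists k => //=; rewrite mk subnKC ?leqnn.
  by case=> n _ [Bom [k /= /andP[mk _] omy]]; split => //; exists k.
apply: nondecreasing_cvg_mu.
- by move=> n; apply: measurableI => //; exact: measurable_visit_between.
- by apply: bigcup_measurable => n _; apply: measurableI => //;
     exact: measurable_visit_between.
- apply/nondecreasing_seqP => n; apply/subsetPset => om.
  case=> Bom [k /= /andP[mk kmn] omy]; split => //; exists k => //=.
  by rewrite mk addnS ltnW.
Qed.

Let hit x y : \bar R := Pr x (visit_from 0 y).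

Lemma hit_within_cvg x y : hit_within n x y @[n --> \oo] --> hit x y.
Proof.
rewrite /hit start_event; last exact: measurable_visit_from.
have := @visit_from_cvg x _ 0 y (measurable_visit 0 [set x]).
apply: cvg_trans; apply: near_eq_cvg; near=> n.
rewrite -(trajectory0 (fun=> x)) trajectory_visit_between big_nil.
by rewrite eqxx mulr1 mul1e.
Unshelve. all: by end_near. Qed.

(** The case n = oo of [trajectory_visit_between], by continuity of the
    measure. *)
Lemma trajectory_visit_from x y m z :
  Pr x (trajectory m z `&` visit_from m y) =
  ((z 0%N == x)%:R * \prod_(0 <= k < m) p (z k) (z k.+1))%:E * hit (z m) y.
Proof.
have mz := measurable_trajectory m z.
rewrite -(cvg_lim (@ereal_hausdorff R) (@visit_from_cvg x _ m y mz)).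
apply: cvg_lim => //; under eq_fun do rewrite trajectory_visit_between.
by apply: cvgeZl => //; exact: hit_within_cvg.
Qed.

Lemma return_visit x y :
  Pr x (visit_from 1 y) = \esum_(w in [set: T]) ((p x w)%:E * hit w y).
Proof.
have mv := measurable_visit_from 1 y.
rewrite start_event //.
have mA : measurable (Z 0%N @^-1` [set x] `&` visit_from 1 y).
  exact: measurableI.
rewrite (@measure_fibres _ _ _ _ (Pr x) (Z 1%N) _ countable_T mA) //=.
apply: eq_esum => w _; pose z k := if k is 0%N then x else w.
have -> : Z 0%N @^-1` [set x] `&` visit_from 1 y `&` Z 1%N @^-1` [set w] =
    trajectory 1 z `&` visit_from 1 y.
  apply/seteqP; split => om.
    by move=> [[omx omy] omw]; split=> // -[|[|//]] _.
  by move=> [omz omy]; do !split=> //; [exact: (omz 0%N)|exact: (omz 1%N)].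
by rewrite trajectory_visit_from big_nat1 eqxx mul1r.
Qed.

Lemma visit_from0 y : visit_from 0 y = \bigcup_n (Z n @^-1` [set y]).
Proof. by apply/seteqP; split => om [k _ omy]; exists k. Qed.

Local Notation F := (hitting_prob Pr Z).

Lemma hitE x y : hit x y = (F x y)%:E.
Proof.
rewrite /hitting_prob -visit_from0 fineK // fin_num_measure //.
exact: measurable_visit_from.
Qed.

Lemma hit_self x : F x x = 1%R.
Proof.
apply: EFin_inj; rewrite -hitE.
rewrite -(cvg_lim (@ereal_hausdorff R) (@hit_within_cvg x x)).
by under eq_fun do rewrite hit_within_self; rewrite lim_cst.
Qed.

Lemma hit_ge0 x y : (0 <= F x y)%R.
Proof. by rewrite -lee_fin -hitE. Qed.

Lemma hit_le1 x y : (F x y <= 1)%R.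
Proof.
by rewrite -lee_fin -hitE probability_le1 //; exact: measurable_visit_from.
Qed.

Lemma hit_step x y : x != y ->
  \esum_(w in [set: T]) (p x w * F w y)%:E = (F x y)%:E.
Proof.
move=> xy; rewrite -hitE /hit start_event; last exact: measurable_visit_from.
have -> : Z 0%N @^-1` [set x] `&` visit_from 0 y =
    Z 0%N @^-1` [set x] `&` visit_from 1 y.
  apply/seteqP; split => om [omx [k _ omy]]; split => //; exists k => //.
  by case: k omy => //= omy; case/eqP: xy; rewrite -omx -omy.
rewrite -start_event; last exact: measurable_visit_from.
by rewrite return_visit; apply: eq_esum => w _; rewrite EFinM -hitE.
Qed.

Lemma hit_return x : transient_chain Pr Z ->
  \esum_(w in [set: T]) (p x w * F w x)%:E < 1.
Proof.
move=> /(_ x); rewrite -[X in Pr x X]/(visit_from 1 x) return_visit.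
by under eq_esum do rewrite hitE -EFinM.
Qed.

Hypothesis irreducible_Z : irreducible_chain Pr Z.

Lemma hit_gt0 x y : (0 < F x y)%R.
Proof.
have [n Pn] := irreducible_Z x y; rewrite -lte_fin -hitE (lt_le_trans Pn) //.
rewrite le_measure ?inE //; first exact: measurable_visit_from.
by move=> om omy; exists n.
Qed.

(** By induction on the number of steps.  All the comparisons of hitting
    probabilities below rest on this minimality. *)
Lemma hit_minimal (g : T -> R) y : (forall x, 0 <= g x)%R -> (1 <= g y)%R ->
  (forall x, x != y -> \esum_(w in [set: T]) (p x w * g w)%:E <= (g x)%:E) ->
  forall x, (F x y <= g x)%R.
Proof.
move=> g0 gy gsup x.
have le_g n : hit_within n x y <= (g x)%:E.
  elim: n x => [|n IHn] x /=; case: eqVneq => [->|xy]; rewrite ?lee_fin //.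
  apply: le_trans (gsup x xy); apply: le_esum => w _; rewrite EFinM.
  by rewrite lee_wpmul2l // lee_fin (markov_ge0 markov_p).
rewrite -lee_fin -hitE; apply: (cvge_le _ (@hit_within_cvg x y)).
exact: nearW.
Qed.

Lemma hit_superharmonic x y :
  \esum_(w in [set: T]) (p x w * F w y)%:E <= (F x y)%:E.
Proof.
have [->|xy] := eqVneq x y; last by rewrite hit_step.
rewrite hit_self -(markov_sum1 markov_p y); apply: le_esum => w _.
by rewrite lee_fin ler_piMr ?hit_le1 ?(markov_ge0 markov_p).
Qed.

(** F(.,y) / F(w,y) is superharmonic and is 1 at w, so it dominates F(.,w). *)
Lemma hit_mul_le x w y : (F x w * F w y <= F x y)%R.
Proof.
have Fwy := hit_gt0 w y; rewrite -ler_pdivlMr //.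
apply: (hit_minimal (g := fun x => F x y / F w y)%R) => [z||z _].
- by rewrite divr_ge0 ?hit_ge0.
- by rewrite divff // gt_eqF.
under eq_esum do rewrite mulrA mulrC EFinM.
rewrite esumZ ?invr_ge0 ?hit_ge0 // => [|v]; last first.
  by rewrite lee_fin mulr_ge0 ?hit_ge0 ?(markov_ge0 markov_p).
rewrite mulrC EFinM lee_wpmul2l ?lee_fin ?invr_ge0 ?hit_ge0 //.
exact: hit_superharmonic.
Qed.

(** The chain can leave C only through w.  Replacing F(.,y) by F(.,w) F(w,y) on
    C gives a function g below F(.,y), by [hit_mul_le], and superharmonic off y:
    by minimality, g is F(.,y). *)
Lemma hit_cut (C : set T) w y :
  (forall x z, C x -> (0 < p x z)%R -> C z \/ z = w) -> ~ (C `\ w) y ->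
  forall x, C x -> F x y = (F x w * F w y)%R.
Proof.
move=> exitC nCy x Cx; apply/eqP; rewrite eq_le hit_mul_le // andbT.
pose g z := (if `[< C z >] then F z w * F w y else F z y)%R.
have gF z : (g z <= F z y)%R.
  by rewrite /g; case: asboolP => // _; exact: hit_mul_le.
have gC z : C z \/ z = w -> g z = (F z w * F w y)%R.
  by rewrite /g; case: asboolP => // nCz [//|->]; rewrite hit_self mul1r.
have gN z : ~ (C `\ w) z -> g z = F z y.
  rewrite /g; case: asboolP => // Cz nCz.
  have -> : z = w by apply: contrapT => zw; exact: nCz.
  by rewrite hit_self mul1r.
rewrite -(gC _ (or_introl Cx)).
apply: hit_minimal => [z||z zy].
- by rewrite /g; case: ifP; rewrite ?mulr_ge0 ?hit_ge0.
- by rewrite gN // hit_self.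
have [[Cz zw]|nCz] := pselect ((C `\ w) z); last first.
  rewrite gN // -hit_step //; apply: le_esum => v _.
  by rewrite lee_fin ler_wpM2l ?(markov_ge0 markov_p).
rewrite gC; last by left.
rewrite mulrC EFinM -(@hit_step z w); last exact/eqP.
rewrite -esumZ ?hit_ge0 // => [|v]; last first.
  by rewrite lee_fin mulr_ge0 ?hit_ge0 ?(markov_ge0 markov_p).
apply: le_esum => v _; rewrite -EFinM lee_fin mulrCA.
have := markov_ge0 markov_p z v; rewrite le_eqVlt => /predU1P[<-|pzv].
  by rewrite !mul0r.
rewrite gC; last exact: exitC pzv.
by rewrite (mulrC (F v w)).
Qed.

End Chain.

(** * Harmonic functions on a finite subtree *)

Lemma esum_seq (R : realType) (T : choiceType) (s : seq T) (a : T -> R) :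
  uniq s -> (forall y, 0 <= a y) -> (forall y, y \notin s -> a y = 0) ->
  (\esum_(y in [set: T]) (a y)%:E = (\sum_(y <- s) a y)%:E)%E.
Proof.
move=> us a0 as0; rewrite (esumID [set` s]) => [|y _]; last by rewrite lee_fin.
rewrite !setTI [X in (_ + X)%E]esum1 ?adde0 => [|y /= /negP/as0->//].
rewrite esum_fset ?finite_seq // => [|y _]; last by rewrite lee_fin.
by rewrite -fsbig_seq // sumEFin.
Qed.

Lemma real_sum_seq (R : realType) (T : choiceType) (s : seq T) (a : T -> R) :
  uniq s -> (forall y, y \notin s -> a y = 0) ->
  real_sum a = (\sum_(y <- s) a y)%:E.
Proof.
move=> us as0; rewrite /real_sum.
rewrite (eq_esum (b := fun y => (Num.max (a y) 0)%:E)); last first.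
  by move=> y _; rewrite funeposE /= EFin_max.
rewrite [X in (_ - X)%E](eq_esum (b := fun y => (Num.max (- a y) 0)%:E));
  last first.
  by move=> y _; rewrite funenegE /= EFin_max.
rewrite !(esum_seq us) => [|y|y /as0->|y|y /as0->];
  rewrite ?le_max ?lexx ?orbT ?oppr0 ?maxxx //.
rewrite -EFinB -sumrB; congr _%:E; apply: eq_bigr => y _.
have [a0|a0] := leP 0 (a y).
  by rewrite max_r ?oppr_le0 // subr0.
by rewrite max_l ?oppr_ge0 ?ltW // sub0r opprK.
Qed.

(** ** The maximum principle *)

Section Walk.
Context {R : realType} {T : choiceType} {e : rel T} {p : T -> T -> R}.
Hypothesis tree_e : is_tree e.
Hypothesis markov_p : is_markov_operator p.
Hypothesis nn_p : nearest_neighbour e p.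

Lemma not_edge_prob0 x y : ~~ e x y -> p x y = 0.
Proof.
move=> /negP nxy; apply/eqP; rewrite eq_le (markov_ge0 markov_p) andbT leNgt.
by apply/negP => /nn_p.
Qed.

Lemma neighbour_sum1 x s : uniq s -> (forall y, e x y -> y \in s) ->
  \sum_(y <- s) p x y = 1.
Proof.
move=> us xs; apply: EFin_inj; rewrite -(markov_sum1 markov_p x).
apply/esym; apply: esum_seq => // y; first exact: (markov_ge0 markov_p).
by move=> ys; apply: not_edge_prob0; apply: contra ys; exact: xs.
Qed.

Lemma harmonic_sum h x s : harmonic_fun p h -> uniq s ->
  (forall y, e x y -> y \in s) -> \sum_(y <- s) p x y * h y = h x.
Proof.
move=> [_ harm_h] us xs; apply: EFin_inj; rewrite -(harm_h x).
apply/esym; apply: real_sum_seq => // y ys.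
by rewrite not_edge_prob0 ?mul0r //; apply: contra ys; exact: xs.
Qed.

Lemma ge0_harmonic (f : T -> R) : (forall x, 0 <= f x) ->
  (forall x, \esum_(y in [set: T]) (p x y * f y)%:E = (f x)%:E)%E ->
  harmonic_fun p f.
Proof.
move=> f0 harm_f.
have pf0 x y : 0 <= p x y * f y by rewrite mulr_ge0 ?(markov_ge0 markov_p).
split=> x.
  rewrite /summable; under eq_esum do rewrite /= ger0_norm //.
  by rewrite harm_f ltry.
rewrite /real_sum [X in (_ - X)%E]esum1 => [|y _]; last first.
  by rewrite funenegE /= -EFin_max max_r // oppr_le0.
rewrite sube0 -harm_f; apply: eq_esum => y _.
by rewrite funeposE /= -EFin_max max_l.
Qed.

(** The maximum over s propagates along the path leading to v: a weighted
    average of values at most m is m only if they are all equal to m. *)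
Lemma maximum_principle (s : seq T) (v : T) (f : T -> R) : uniq s ->
  (forall z w, z \in s -> z != v -> e z w -> w \in s) ->
  (forall z, z \in s -> z != v -> \sum_(w <- s) p z w * f w = f z) ->
  forall z, z \in s -> f z <= f v.
Proof.
move=> us closed_s harm_f z zs.
have [m ms maxm] : exists2 m, m \in s & forall w, w \in s -> f w <= f m.
  suff [m ms maxm] : exists2 m,
      m \in z :: s & forall w, w \in z :: s -> f w <= f m.
    exists m; first by case/predU1P: ms => [->|].
    by move=> w ws; apply: maxm; rewrite inE ws orbT.
  elim: (s) => [|y s' [m ms maxm]].
    by exists z; rewrite ?mem_head // => w; rewrite mem_seq1 => /eqP->.
  have perm_zy w : (w \in [:: z, y & s']) = (w == y) || (w \in z :: s').
    by rewrite !inE orbCA.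
  have [ym|my] := leP (f y) (f m).
    exists m; first by rewrite perm_zy ms orbT.
    by move=> w; rewrite perm_zy => /predU1P[->//|/maxm].
  exists y; first by rewrite perm_zy eqxx.
  move=> w; rewrite perm_zy => /predU1P[->//|/maxm wm].
  by rewrite (le_trans wm) // ltW.
suff <- : f m = f v by exact: maxm.
have [q pq lq] := tree_connected tree_e m v.
suff follow u : u \in s -> f m = f u -> path e u q -> last u q = v -> f m = f v.
  exact: (follow m).
elim: q u {pq lq} => [|w q IHq] u us' fu /=; first by move=> _ <-.
move=> /andP[euw pq] lq.
have [uv|uv] := eqVneq u v.
  by rewrite fu uv.
have ws := closed_s _ _ us' uv euw.
apply: (IHq w) => //; rewrite fu; apply/eqP; rewrite -subr_eq0.
have puw : 0 < p u w by apply/nn_p.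
have : \sum_(x <- s) p u x * (f u - f x) = 0.
  under eq_bigr do rewrite mulrBr; rewrite sumrB -mulr_suml harm_f //.
  by rewrite neighbour_sum1 ?mul1r ?subrr // => x; exact: closed_s.
move/eqP; rewrite big_seq psumr_eq0 => [|x xs]; last first.
  by rewrite mulr_ge0 ?(markov_ge0 markov_p) // subr_ge0 -fu maxm.
move=> /allP/(_ w ws); by rewrite ws /= mulf_eq0 gt_eqF //= fu subr_eq0.
Qed.

Lemma finite_harmonic_constant (s : seq T) (v : T) (f : T -> R) : uniq s ->
  (forall z w, z \in s -> z != v -> e z w -> w \in s) ->
  (forall z, z \in s -> z != v -> \sum_(w <- s) p z w * f w = f z) ->
  forall z, z \in s -> f z = f v.
Proof.
move=> us closed_s harm_f z zs; apply/eqP; rewrite eq_le.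
rewrite (maximum_principle us closed_s harm_f zs) /= -lerN2.
apply: (maximum_principle (f := fun x => - f x) us closed_s) => // x xs xv.
by under eq_bigr do rewrite mulrN; rewrite sumrN harm_f.
Qed.

End Walk.

(** ** Expansion in hitting probabilities *)

Section Subtree.
Context {R : realType} {d : measure_display} {T : measurableType d}.
Context {d' : measure_display} {Omega : measurableType d'}.
Context {e : rel T} {p : T -> T -> R} {Pr : T -> probability Omega R}.
Context {Z : nat -> {mfun Omega >-> T}}.
Hypothesis countable_T : countable [set: T].
Hypothesis powerset_T : forall A : set T, measurable A.
Hypothesis tree_e : is_tree e.
Hypothesis markov_p : is_markov_operator p.
Hypothesis nn_p : nearest_neighbour e p.
Hypothesis chain_Z : is_markov_chain p Pr Z.
Hypothesis irreducible_Z : irreducible_chain Pr Z.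
Hypothesis transient_Z : transient_chain Pr Z.
Context {S : seq T} {proj : T -> T}.
Hypothesis uniq_S : uniq S.
Hypothesis retr : is_retraction e S proj.

Local Notation F := (hitting_prob Pr Z).

Let F_self := hit_self countable_T powerset_T markov_p chain_Z.
Let F_step := hit_step countable_T powerset_T markov_p chain_Z.
Let F_cut := @hit_cut _ _ _ _ _ _ _ _ countable_T powerset_T markov_p chain_Z
  irreducible_Z.
Let F_return x :=
  hit_return countable_T powerset_T markov_p chain_Z x transient_Z.

Lemma retraction_crossing x z : e x z -> proj x <> proj z -> x \in S /\ z \in S.
Proof.
move=> exz nxz; split; apply: contraT => nS; case: nxz.
  exact: (retraction_edge retr exz).
by apply/esym; apply: (retraction_edge retr) nS; rewrite (tree_sym tree_e).
Qed.

(** The complement of the fibre of z can be left only through the vertex of S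
    in that fibre. *)
Lemma hit_into_fibre a z : a \in S -> F a z = F a (proj z) * F (proj z) z.
Proof.
move=> aS; have [->|az] := eqVneq a (proj z).
  by rewrite F_self mul1r.
apply: (F_cut (C := [set x | proj x <> proj z])) => /=.
- move=> x y /= xz /nn_p exy.
  have [yz|yz] := pselect (proj y = proj z); last by left.
  have [_ yS] : x \in S /\ y \in S by apply: retraction_crossing; rewrite ?yz.
  by right; rewrite -yz (retraction_id retr).
- by case.
- by rewrite (retraction_id retr) //; apply/eqP.
Qed.

Lemma hit_out_of_fibre z a : a \in S -> F z a = F z (proj z) * F (proj z) a.
Proof.
move=> aS; have [zE|zz] := eqVneq z (proj z).
  by rewrite -zE F_self mul1r.
apply: (F_cut (C := [set x | proj x = proj z /\ x <> proj z])) => /=.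
- move=> x y /= [xz xnz] /nn_p exy.
  have [yz|yz] := pselect (y = proj z); first by right.
  left; split=> //.
  apply: contrapT => pyz.
  have [xS _] : x \in S /\ y \in S.
    by apply: retraction_crossing; rewrite // xz => /esym.
  by apply: xnz; rewrite -xz (retraction_id retr).
- by case=> -[+ anz] _; rewrite (retraction_id retr).
- by split=> //; apply/eqP.
Qed.

(** The neighbours of v outside S lie in the fibre of v, so this is the
    probability that the chain returns to v by an excursion outside S. *)
Definition outer_return (v : T) : R :=
  fine (\esum_(y in ~` [set` S]) (p v y * F y v)%:E).

Definition return_prob (v : T) : R :=
  fine (\esum_(y in [set: T]) (p v y * F y v)%:E).

Let pF_ge0 x y z : (0 <= (p x y * F y z)%:E)%E.
Proof. by rewrite lee_fin mulr_ge0 ?(markov_ge0 markov_p) // hit_ge0. Qed.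

Lemma return_probE v :
  (\esum_(y in [set: T]) (p v y * F y v)%:E = (return_prob v)%:E)%E.
Proof.
rewrite /return_prob fineK // ge0_fin_numE; last exact: esum_ge0.
exact: lt_trans (F_return v) (ltry 1).
Qed.

Lemma return_prob_lt1 v : return_prob v < 1.
Proof.
rewrite -lte_fin -return_probE.
exact: F_return.
Qed.

Lemma outer_returnE v :
  (\esum_(y in ~` [set` S]) (p v y * F y v)%:E = (outer_return v)%:E)%E.
Proof.
rewrite /outer_return fineK // ge0_fin_numE; last exact: esum_ge0.
apply: le_lt_trans (ltry (return_prob v)); rewrite -return_probE.
by rewrite esum_mkcond; apply: le_esum => y _; case: ifP.
Qed.

(** The walk started at a neighbour of v outside S has to come back to v before
    it reaches a. *)
Lemma hit_split v a : v \in S -> a \in S ->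
  (\esum_(y in [set: T]) (p v y * F y a)%:E =
   (\sum_(y <- S) p v y * F y a + outer_return v * F v a)%:E)%E.
Proof.
move=> vS aS; rewrite (esumID [set` S]) // !setTI EFinD; congr (_ + _)%E.
  rewrite esum_fset //; last exact: finite_seq.
  by rewrite -fsbig_seq // sumEFin.
rewrite mulrC EFinM -outer_returnE !(esum_mkcond (~` _)) -esumZ; last 2 first.
- exact: hit_ge0.
- by move=> y; case: ifP.
apply: eq_esum => y _; case: ifPn => yS; last by rewrite mule0.
rewrite -EFinM; congr _%:E; have [evy|nvy] := boolP (e v y); last first.
  by rewrite (not_edge_prob0 markov_p nn_p nvy) !mul0r mulr0.
have projy : proj y = v.
  have /negP yS' : ~ y \in S by move: yS; rewrite inE.
  rewrite -[RHS](retraction_id retr vS); apply: (retraction_edge retr) yS'.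
  by rewrite (tree_sym tree_e).
by rewrite (hit_out_of_fibre y aS) projy mulrA mulrC.
Qed.

(** The operator I - P on the finite subtree S, where the excursions of the
    chain outside S count as staying put. *)
Definition reduced_laplacian (f : T -> R) (v : T) : R :=
  f v - outer_return v * f v - \sum_(y <- S) p v y * f y.

Lemma reduced_laplacian_hit v a : v \in S -> a \in S ->
  reduced_laplacian (fun x => F x a) v = (v == a)%:R * (1 - return_prob a).
Proof.
move=> vS aS; rewrite /reduced_laplacian -addrA -opprD [_ * _ + _]addrC.
have splitE x : (\esum_(y in [set: T]) (p v y * F y a)%:E = x%:E)%E ->
    \sum_(y <- S) p v y * F y a + outer_return v * F v a = x.
  by rewrite hit_split // => -[].
have [va|va] := eqVneq v a; last by rewrite (splitE _ (F_step va)) subrr mul0r.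
by rewrite (splitE (return_prob a)) -?va ?F_self ?mul1r // return_probE.
Qed.

(** By the maximum principle both h and F(.,v) are constant on the finite fibre,
    so the excursions outside S do keep the value of h. *)
Lemma reduced_laplacian_harmonic h v : harmonic_fun p h -> v \in S ->
  finite_set (proj @^-1` [set v]) -> reduced_laplacian h v = 0.
Proof.
move=> harm_h vS /finite_seqP[c0 c0E].
pose c := undup c0; have uc : uniq c := undup_uniq _.
have inc y : (y \in c) = (proj y == v).
  rewrite mem_undup; apply/idP/eqP => [yc|yv].
    by have : [set` c0] y by []; rewrite -c0E.
  by have : (proj @^-1` [set v]) y by []; rewrite c0E.
have vc : v \in c by rewrite inc (retraction_id retr).
have closed_c z w : z \in c -> z != v -> e z w -> w \in c.
  rewrite !inc => /eqP zv znv ezw; apply: contraT => /eqP wv.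
  have [zS _] : z \in S /\ w \in S.
    by apply: retraction_crossing; rewrite // zv => /esym.
  by move: znv; rewrite -zv (retraction_id retr) // eqxx.
have hc y : y \in c -> h y = h v.
  apply: (finite_harmonic_constant tree_e markov_p nn_p uc closed_c) => z zc zv.
  by apply: (harmonic_sum markov_p nn_p) => // w; exact: closed_c.
have Fc y : y \in c -> F y v = 1.
  move=> yc; rewrite -(F_self v).
  apply: (finite_harmonic_constant tree_e markov_p nn_p (f := F^~ v)
            uc closed_c) yc => z zc zv.
  apply: EFin_inj.
  rewrite -(F_step zv).
  apply/esym; apply: esum_seq => // [w|w wc]; first by rewrite -lee_fin.
  rewrite (not_edge_prob0 markov_p nn_p) ?mul0r //; apply: contra wc.
  exact: closed_c.
pose s := undup (S ++ c); have us : uniq s := undup_uniq _.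
have vs y : e v y -> y \in s.
  move=> evy; rewrite mem_undup mem_cat inc; have [//|yS /=] := boolP (y \in S).
  rewrite -(retraction_id retr vS) eq_sym; apply/eqP.
  by apply/esym; apply: (retraction_edge retr) yS; rewrite (tree_sym tree_e).
have split_s f : \sum_(y <- s) p v y * f y =
    \sum_(y <- S) p v y * f y + \sum_(y <- s | y \notin S) p v y * f y.
  rewrite (bigID (mem S)) /=; congr (_ + _); rewrite -big_filter.
  apply: perm_big; apply: uniq_perm => //; first exact: filter_uniq.
  by move=> y; rewrite mem_filter mem_undup mem_cat; case: (y \in S).
have hE : h v =
    \sum_(y <- S) p v y * h y + \sum_(y <- s | y \notin S) p v y * h v.
  rewrite -{1}(harmonic_sum markov_p nn_p harm_h us vs) split_s; congr (_ + _).
  rewrite big_seq_cond [RHS]big_seq_cond; apply: eq_bigr => y /andP[ys yS].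
  by rewrite hc //; move: ys; rewrite mem_undup mem_cat (negbTE yS).
suff rE : outer_return v = \sum_(y <- s | y \notin S) p v y.
  by rewrite /reduced_laplacian {1}hE rE mulr_suml addrK subrr.
apply: EFin_inj; rewrite -outer_returnE esum_mkcond.
rewrite (eq_esum (b := fun y => (if y \notin S then p v y * F y v else 0)%:E)).
  rewrite (esum_seq us) => [|y|y ys]; last 2 first.
  - by case: ifP => //; rewrite -lee_fin.
  - case: ifP => // _; rewrite (not_edge_prob0 markov_p nn_p) ?mul0r //.
    by apply: contra ys; exact: vs.
  rewrite -big_mkcond; congr _%:E.
  rewrite big_seq_cond [RHS]big_seq_cond; apply: eq_bigr => y /andP[ys yS].
  by rewrite Fc ?mulr1 //; move: ys; rewrite mem_undup mem_cat (negbTE yS).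
move=> y _; rewrite in_setC; have -> : (y \in [set` S]) = (y \in S).
  by apply/idP/idP; rewrite inE.
by case: (y \in S).
Qed.

(** By [reduced_laplacian_hit] the matrix of hitting probabilities, its columns
    divided by 1 - return_prob v > 0, is a right inverse of the reduced
    Laplacian.  These matrices are square, so it is also a left inverse, and
    applying it to the reduced Laplacian of h gives back h. *)
Lemma harmonic_hit_expansion h : harmonic_fun p h ->
  exists c : T -> R,
    (forall a, a \in S -> h a = \sum_(v <- S) F a v * c v) /\
    (forall v, v \in S -> finite_set (proj @^-1` [set v]) -> c v = 0).
Proof.
move=> harm_h; exists (fun v => reduced_laplacian h v / (1 - return_prob v)).
split=> [a aS|v vS finv]; last by rewrite reduced_laplacian_harmonic ?mul0r.
pose n := size S; pose s (i : 'I_n) := nth point S i.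
have sS i : s i \in S by rewrite mem_nth.
have s_inj i j : (s i == s j) = (i == j) by rewrite nth_uniq.
have sumS f : \sum_(y <- S) f y = \sum_(i < n) f (s i) :> R.
  by rewrite (big_nth point) big_mkord.
pose A : 'M[R]_n := \matrix_(i, j)
  ((i == j)%:R * (1 - outer_return (s j)) - p (s i) (s j)).
pose G : 'M[R]_n := \matrix_(i, j) (F (s i) (s j) / (1 - return_prob (s j))).
have AE f : A *m (\col_i f (s i)) = \col_i reduced_laplacian f (s i).
  apply/colP => i; rewrite !mxE /reduced_laplacian sumS.
  under eq_bigr do rewrite !mxE mulrBl.
  rewrite sumrB; congr (_ - _); rewrite (bigD1 i) //= big1 ?addr0 => [|j ji].
    by rewrite eqxx mul1r mulrBl mul1r.
  by rewrite eq_sym (negbTE ji) !mul0r.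
have AG : A *m G = 1%:M.
  apply/matrixP => i j; rewrite mxE.
  under eq_bigr do rewrite [G _ _]mxE mulrA.
  rewrite -mulr_suml (_ : \sum_(k < n) _ =
      (A *m \col_k F (s k) (s j)) i 0); last first.
    by rewrite [RHS]mxE; apply: eq_bigr => k _; rewrite !mxE.
  rewrite (AE (fun x => F x (s j))) !mxE reduced_laplacian_hit // s_inj.
  by rewrite mulfK // gt_eqF // subr_gt0 return_prob_lt1.
have : G *m (A *m \col_i h (s i)) = \col_i h (s i).
  by rewrite mulmxA (mulmx1C AG) mul1mx.
have an : (index a S < n)%N by rewrite index_mem.
move/colP/(_ (Ordinal an)); rewrite AE !mxE /s /= nth_index // => <-.
rewrite sumS; apply: eq_bigr => j _.
by rewrite !mxE /s /= nth_index // mulrAC mulrA.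
Qed.

End Subtree.

(** * Finitely supported measures *)

Section FiniteSupport.
Context {R : realType} {d : measure_display} {T : measurableType d}.
Hypothesis powerset_T : forall A : set T, measurable A.

Section Measure.
Context {nu : {measure set T -> \bar R}} {S : seq T}.
Hypothesis finite_nu : (nu [set: T] < +oo)%E.
Hypothesis null_nu : nu (~` [set` S]) = 0%E.

Lemma finite_support_integrable (h : T -> R) :
  nu.-integrable [set: T] (EFin \o h).
Proof.
apply/(negligible_integrable (N := ~` [set` S])) => //.
rewrite setTD setCK; apply: measurable_bounded_integrable => //.
  by apply: le_lt_trans finite_nu; rewrite le_measure ?inE.
exists (\sum_(a <- S) `|h a|); split; first exact: num_real.
move=> M ltM x /= xS; apply: le_trans (ltW ltM).
by rewrite (big_rem x) //= lerDl sumr_ge0.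
Qed.

Lemma finite_support_integral (h : T -> R) : uniq S ->
  (\int[nu]_x (h x)%:E = \sum_(a <- S) (h a)%:E * nu [set a])%E.
Proof.
move=> uS; rewrite (negligible_integral (N := ~` [set` S])) //; last first.
  exact: finite_support_integrable.
have -> : [set: T] `\` ~` [set` S] = \big[setU/set0]_(a <- S) [set a].
  by rewrite setTD setCK -bigcup_seq; apply/seteqP; split => x /=;
     [exists x|case=> y yS /= ->].
rewrite integral_bigsetU_EFin //; last first.
  apply/trivIsetP => x y _ _ /eqP xy; apply/seteqP.
  by split => // z [/= -> /xy].
apply: eq_bigr => a _; rewrite -integral_cst //.
by apply: eq_integral => x; rewrite inE /= => ->.
Qed.

End Measure.

Context {mu : {charge set T -> \bar R}} {S : seq T}.
Hypothesis uniq_S : uniq S.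
Hypothesis null_mu : forall B, [set` S] `&` B = set0 -> mu B = 0%E.

Let hahn := svalP (hahn_pair mu).

Let pos_null : jordan_pos hahn (~` [set` S]) = 0%E.
Proof.
rewrite jordan_posE cjordan_posE /crestr0 mem_set // /crestr.
by apply: null_mu; rewrite setIA setICr set0I.
Qed.

Let neg_null : jordan_neg hahn (~` [set` S]) = 0%E.
Proof.
rewrite jordan_negE cjordan_negE /crestr0 mem_set // /crestr.
by rewrite null_mu ?oppe0 // setIA setICr set0I.
Qed.

Let pos_fin A : jordan_pos hahn A \is a fin_num.
Proof. exact: fin_num_measure. Qed.

Let neg_fin A : jordan_neg hahn A \is a fin_num.
Proof. exact: fin_num_measure. Qed.

Lemma finite_support_variation_integrable (h : T -> R) :
  (Defs.total_variation mu).-integrable [set: T] (EFin \o h).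
Proof.
apply: (@finite_support_integrable _ S).
- by rewrite /Defs.total_variation /charge_variation /= lte_add_pinfty //
     ltey_eq ?pos_fin ?neg_fin.
- have -> : Defs.total_variation mu (~` [set` S]) =
    (jordan_pos hahn (~` [set` S]) + jordan_neg hahn (~` [set` S]))%E by [].
  by rewrite pos_null neg_null adde0.
Qed.

(** The integrals for the positive and the negative parts of the measure are
    finite sums, as well as its total mass, which is the integral of 1. *)
Lemma finite_support_mv_defect (h : T -> R) (o : T) :
  mv_defect h mu o = (\sum_(a <- S) fine (mu [set a]) * (h a - h o))%:E.
Proof.
have posE f : (\int[jordan_pos hahn]_x (f x)%:E =
    (\sum_(a <- S) f a * fine (jordan_pos hahn [set a]))%:E)%E.
  rewrite (finite_support_integral _ pos_null) ?ltey_eq ?pos_fin //.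
  by rewrite -sumEFin; apply: eq_bigr => a _; rewrite EFinM fineK.
have negE f : (\int[jordan_neg hahn]_x (f x)%:E =
    (\sum_(a <- S) f a * fine (jordan_neg hahn [set a]))%:E)%E.
  rewrite (finite_support_integral _ neg_null) ?ltey_eq ?neg_fin //.
  by rewrite -sumEFin; apply: eq_bigr => a _; rewrite EFinM fineK.
have muE A : mu A = (jordan_pos hahn A - jordan_neg hahn A)%E.
  by rewrite (jordan_decomp hahn) // /cadd /= cscaleN1.
have massE : mu [set: T] = (\sum_(a <- S) fine (mu [set a]))%:E.
  rewrite muE -(mul1e (jordan_pos _ _)) -(mul1e (jordan_neg _ _)).
  rewrite -!integral_cst // (posE (fun=> 1)) (negE (fun=> 1)) -EFinB -sumrB.
  congr _%:E; apply: eq_bigr => a _.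
  by rewrite !mul1r muE fineB.
rewrite /mv_defect /charge_integral posE negE massE -EFinM -!EFinB -sumrB.
congr _%:E; rewrite mulr_suml -sumrB; apply: eq_bigr => a _.
by rewrite -mulrBr muE fineB // [RHS]mulrBr [h a * _]mulrC.
Qed.

End FiniteSupport.

(** * Points of the Martin boundary *)

Section Boundary.
Context {R : realType} {T : choiceType} {That : topologicalType}.
Context {i : T -> That}.
Hypothesis cptn : is_compactification i.

(** By compactness the images of the cofinite subsets of C have a common cluster
    point, which is not a vertex since the vertices are isolated. *)
Lemma boundary_accumulation (C : set T) : infinite_set C ->
  exists xi, ~ range i xi /\
    forall (f : That -> R) c, continuous f -> (forall z, C z -> f (i z) = c) ->
      f xi = c.
Proof.
move=> infC; pose G : set_system That := [set U | finite_set (C `\` i @^-1` U)].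
have G_filter : ProperFilter G.
  split; first by rewrite /G /= preimage_set0 setD0.
  split; first by rewrite /G /= preimage_setT setDT; exact: finite_set0.
    move=> A B GA GB; rewrite /G /= preimage_setI setDIr.
    by rewrite finite_setU.
  move=> A B AB; apply: sub_finite_set => z [Cz nBz]; split => // Az.
  by apply: nBz; exact: AB.
have [xi [_ xi_cluster]] := cptn_compact cptn G_filter filterT.
exists xi; split=> [[t _ xiE]|f c f_cont fC].
  have nbhs_xi : nbhs xi (i @` [set t]).
    by apply: open_nbhs_nbhs; split; [exact: cptn_open|exists t].
  have G_co : G (~` [set i t]).
    apply: (sub_finite_set (B := [set t])); last exact: finite_set1.
    by move=> z [_ /= /contrapT /(cptn_inj cptn)].
  have [y [ny [t' /= t'E yE]]] := xi_cluster _ _ G_co nbhs_xi.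
  by apply: ny; rewrite -yE t'E.
apply: contrapT => /eqP fxi.
have nbhs_xi : nbhs xi (f @^-1` [set y | y != c]).
  apply: open_nbhs_nbhs; split => //.
  by move/continuousP: f_cont; apply; exact: open_neq.
have GC : G (i @` C).
  apply: (sub_finite_set (B := set0)); last exact: finite_set0.
  by move=> z [Cz nCz]; apply: nCz; exists z.
have [y [[z Cz zy] /=]] := xi_cluster _ _ GC nbhs_xi.
by rewrite -zy fC ?eqxx.
Qed.

(** The retraction has finitely many fibres, and their union is dense.  A
    boundary point does not belong to the closed sets formed by the finite
    fibres; nor to the closure of a fibre where some f a has another value. *)
Lemma boundary_fibre (S : seq T) (proj : T -> T) (I : eqType) (A : seq I)
    (f : I -> That -> R) (g : I -> T -> R) (xi : That) :
  (forall z, proj z \in S) -> (forall a, a \in A -> continuous (f a)) ->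
  (forall a z, a \in A -> f a (i z) = g a (proj z)) -> ~ range i xi ->
  exists v, [/\ v \in S, infinite_set (proj @^-1` [set v])
    & forall a, a \in A -> f a xi = g a v].
Proof.
move=> projS f_cont fg nxi; apply: contrapT => nex.
have away v : v \in S -> \forall x \near xi, forall z, proj z = v -> x <> i z.
  move=> vS; have [finv|infv] := pselect (finite_set (proj @^-1` [set v])).
    have : closed (i @` (proj @^-1` [set v])).
      have /accessible_finite_set_closed :=
        hausdorff_accessible (cptn_hausdorff cptn).
      by apply; exact: finite_image.
    move/closed_openC => oC; have : nbhs xi (~` (i @` (proj @^-1` [set v]))).
      by apply: open_nbhs_nbhs; split => // -[z _ zxi]; apply: nxi; exists z.
    by apply: filterS => x nx z zv xE; apply: nx; exists z.
  have [a [aA fxi]] : exists a, a \in A /\ f a xi <> g a v.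
    apply: contrapT => na; apply: nex; exists v; split => // a aA.
    by apply: contrapT => fxi; apply: na; exists a.
  have : nbhs xi (f a @^-1` [set y | y != g a v]).
    apply: open_nbhs_nbhs; split; last exact/eqP.
    by move/continuousP: (f_cont a aA); apply; exact: open_neq.
  by apply: filterS => x /eqP fx z zv xE; apply: fx; rewrite xE fg // zv.
have : \forall x \near xi,
    forall v, v \in S -> forall z, proj z = v -> x <> i z.
  elim: S away {projS nex} => [|v S IHS] away; first exact: nearW.
  have aS : \forall x \near xi,
      forall w, w \in S -> forall z, proj z = w -> x <> i z.
    by apply: IHS => w wS; apply: away; rewrite inE wS orbT.
  have := away v (mem_head _ _); apply: filterS2 aS => x xS xv w.
  by rewrite inE => /predU1P[->|/xS].
rewrite -nbhs_nearE nbhsE => -[W [oW Wxi] WS].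
have [x [Wx [z _ zx]]] := cptn_dense cptn (ex_intro _ xi Wxi) oW.
by apply: (WS _ Wx (proj z)) => //; rewrite zx.
Qed.

End Boundary.

(** * Martin kernels *)

Section Kernel.
Context {R : realType} {d : measure_display} {T : measurableType d}.
Context {d' : measure_display} {Omega : measurableType d'}.
Context {e : rel T} {p : T -> T -> R} {Pr : T -> probability Omega R}.
Context {Z : nat -> {mfun Omega >-> T}}.
Hypothesis countable_T : countable [set: T].
Hypothesis powerset_T : forall A : set T, measurable A.
Hypothesis tree_e : is_tree e.
Hypothesis markov_p : is_markov_operator p.
Hypothesis nn_p : nearest_neighbour e p.
Hypothesis chain_Z : is_markov_chain p Pr Z.
Hypothesis irreducible_Z : irreducible_chain Pr Z.
Context {o : T}.

Local Notation F := (hitting_prob Pr Z).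
Local Notation k := (martin_kernel Pr Z o).

Let F_gt0 x y : 0 < F x y := hit_gt0 powerset_T irreducible_Z x y.

(** The factor F(proj z, z) is common to the numerator and the denominator. *)
Lemma kernel_fibre (S : seq T) (proj : T -> T) (a z : T) :
  is_retraction e S proj -> o \in S -> a \in S -> k a z = k a (proj z).
Proof.
move=> retr oS aS; rewrite /martin_kernel.
have into b : b \in S -> F b z = F b (proj z) * F (proj z) z.
  exact: (hit_into_fibre countable_T powerset_T tree_e markov_p nn_p chain_Z
            irreducible_Z retr).
by rewrite (into a aS) (into o oS) -mulf_div divff ?mulr1 // gt_eqF.
Qed.

(** kappa is the kernel of the end of the ray.  Past a vertex r N deeper than z,
    both z and o see the ray through r N, so that k(z, r n) no longer depends on
    n; and F(., r n) is harmonic at z as soon as r n is deeper than z. *)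
Lemma ray_kernel_harmonic (par : T -> T) (dep : T -> nat) (r : nat -> T) :
  is_rooted e o par dep -> (forall n, r n != o) ->
  (forall n, par (r n.+1) = r n) ->
  exists2 kappa, harmonic_fun p kappa &
    forall z n, (dep z < n)%N -> kappa z = k z (r n).
Proof.
move=> rooted ro rpar.
have dep_r n : (n <= dep (r n))%N.
  elim: n => // n IHn; rewrite (rooted_dep rooted (ro n.+1)) rpar.
  by rewrite ltnS.
have desc_r N m : descendants par (r N) (r (N + m)%N).
  elim: m => [|m IHm]; first by rewrite addn0; exact: descendants_refl.
  by rewrite addnS; apply: descendants_par; rewrite rpar.
have cut N n z : (N <= n)%N -> ~ descendants par (r N) z ->
    F z (r n) = F z (r N) * F (r N) (r n).
  move=> Nn; apply: (@hit_cut _ _ _ _ _ _ _ _ countable_T powerset_T markov_p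
    chain_Z irreducible_Z (~` descendants par (r N))).
    move=> x y nx /nn_p exy; have [ry|nry] := pselect (descendants par (r N) y).
      by right; exact: (descendants_edge rooted exy nx ry).
    by left.
  by case=> + _; apply; rewrite -(subnKC Nn).
have stable z N n : (dep z < N)%N -> (N <= n)%N -> k z (r n) = k z (r N).
  move=> zN Nn.
  have nz : ~ descendants par (r N) z.
    move=> /(dep_descendants rooted)/(leq_trans (dep_r N)).
    by rewrite leqNgt zN.
  have no : ~ descendants par (r N) o.
    by move=> /(root_descendants rooted)/eqP; rewrite (negbTE (ro N)).
  rewrite /martin_kernel (cut N n z) // (cut N n o) //.
  by rewrite -mulf_div divff ?mulr1 // gt_eqF.
pose kappa z := k z (r (dep z).+1).
have kappaE z n : (dep z < n)%N -> kappa z = k z (r n).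
  by move=> zn; rewrite (stable z (dep z).+1).
exists kappa => //; apply: ge0_harmonic => // [x|x].
  by rewrite divr_ge0 ?hit_ge0.
(* The neighbours of x have depth at most dep x + 1. *)
pose n := (dep x).+2; have xrn : x != r n.
  by apply: contraTneq (dep_r n) => <-; rewrite -ltnNge ltnW.
rewrite (eq_esum
  (b := fun y => ((F o (r n))^-1%:E * (p x y * F y (r n))%:E)%E)).
  rewrite esumZ ?invr_ge0 ?hit_ge0 // => [|y]; last first.
    by rewrite lee_fin mulr_ge0 ?(markov_ge0 markov_p) // hit_ge0.
  rewrite (hit_step countable_T powerset_T markov_p chain_Z xrn) -EFinM mulrC.
  by rewrite (kappaE x n) // leqnSn.
move=> y _; rewrite -EFinM; congr _%:E; have [exy|nxy] := boolP (e x y).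
  have yn : (dep y < n)%N by rewrite ltnS (dep_edge rooted).
  by rewrite (kappaE y n) // /martin_kernel mulrA mulrC.
by rewrite (not_edge_prob0 markov_p nn_p nxy) !mul0r mulr0.
Qed.

End Kernel.

(** * The mean value properties *)

Theorem theorem9 (R : realType) (d : measure_display) (T : measurableType d)
    (countable_T : countable [set: T])
    (powerset_T : forall A : set T, measurable A)
    (e : rel T) (tree_T : is_tree e)
    (p : T -> T -> R) (markov_p : is_markov_operator p)
    (nn_p : nearest_neighbour e p)
    (d' : measure_display) (Omega : measurableType d')
    (Pr : T -> probability Omega R) (Z : nat -> {mfun Omega >-> T})
    (chain_Z : is_markov_chain p Pr Z)
    (irreducible_Z : irreducible_chain Pr Z)
    (transient_Z : transient_chain Pr Z)
    (o : T)
    (That : topologicalType) (i : T -> That)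
    (martin_That : is_martin_compactification (martin_kernel Pr Z o) i)
    (K : T -> That -> R) (ext_K : extends_kernel (martin_kernel Pr Z o) i K)
    (mu : {charge set T -> \bar R}) (fin_mu : finitely_supported mu) :
  let martin_boundary_mean_value :=
    forall xi : That, (~` range i) xi -> mv_defect (K ^~ xi) mu o = 0%E in
  [/\ strong_mean_value p mu o -> weak_mean_value p mu o,
      martin_boundary_mean_value -> strong_mean_value p mu o
    & infinitely_branching e ->
      strong_mean_value p mu o -> martin_boundary_mean_value].
Proof.
set k := martin_kernel Pr Z o in martin_That ext_K *.
have [par [dep rooted]] := tree_rooted o tree_T.
have [A /finite_seqP[s As] muA] := fin_mu.
have [S uniq_S [clS sS]] := ancestor_closed_hull rooted s.
have [oS _] := clS.
have [proj retr] := ancestor_retraction rooted clS.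
have null_mu B : [set` S] `&` B = set0 -> mu B = 0%E.
  move=> SB; apply: muA; apply/seteqP; split => // x [].
  by rewrite As => /sS xS Bx; rewrite -SB.
pose L (f : T -> R) := \sum_(a <- S) fine (mu [set a]) * (f a - f o).
have defectE f : mv_defect f mu o = (L f)%:E.
  exact: finite_support_mv_defect.
have cptn := martin_cptn martin_That.
have K_cont a : continuous (K a) by have [] := ext_K a.
have K_fibre a z : a \in S -> K a (i z) = k a (proj z).
  move=> aS; have [_ ->] := ext_K a.
  exact: (kernel_fibre countable_T powerset_T tree_T markov_p nn_p chain_Z
            irreducible_Z z retr).
have L_eq f g : (forall a, a \in S -> f a = g a) -> L f = L g.
  move=> fg; rewrite /L big_seq [RHS]big_seq; apply: eq_bigr => a aS.
  by rewrite !fg.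
move=> martin_boundary_mean_value; split.
- move=> strong h harm_h _; apply: strong => //.
  exact: (finite_support_variation_integrable powerset_T null_mu).
- move=> bmv h harm_h _; rewrite defectE.
  (* The accumulation point of the fibre of v has the kernel of v on S. *)
  have Lk v : v \in S -> ~ finite_set (proj @^-1` [set v]) -> L (k^~ v) = 0.
    move=> vS infv.
    have [xi [nxi xiE]] := boundary_accumulation (R := R) cptn infv.
    have := bmv xi nxi; rewrite defectE => -[<-].
    apply: L_eq => a aS; apply/esym; apply: (xiE _ _ (K_cont a)) => z zv.
    by rewrite K_fibre // zv.
  have [c [hE c0]] := harmonic_hit_expansion countable_T powerset_T tree_T
    markov_p nn_p chain_Z irreducible_Z transient_Z uniq_S retr harm_h.
  have -> : L h = \sum_(v <- S) c v * hitting_prob Pr Z o v * L (k^~ v).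
    rewrite (L_eq _ _ hE) /L.
    under eq_bigr do rewrite -sumrB mulr_sumr.
    rewrite exchange_big; apply: eq_bigr => v _ /=.
    rewrite mulr_sumr; apply: eq_bigr => a _.
    have kE b : hitting_prob Pr Z o v * k b v = hitting_prob Pr Z b v.
      by rewrite mulrC divfK // gt_eqF // hit_gt0.
    rewrite [RHS]mulrCA -mulrBl mulrC -[c v * _ * _]mulrA.
    by rewrite [_ * (k a v - _)]mulrBr !kE [_ * c v]mulrC mulrC.
  rewrite big_seq big1 // => v vS.
  have [finv|infv] := pselect (finite_set (proj @^-1` [set v])).
    by rewrite c0 // !mul0r.
  by rewrite Lk // mulr0.
- move=> brT strong xi nxi; rewrite defectE.
  have [v [vS infv KE]] := boundary_fibre cptn (retraction_in retr)
    (fun a _ => K_cont a) K_fibre nxi.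
  have [r [ro rpar rv]] := ray_in_fibre rooted tree_T brT clS retr vS infv.
  have [kappa harm_kappa kappaE] := ray_kernel_harmonic countable_T powerset_T
    markov_p nn_p chain_Z irreducible_Z rooted ro rpar.
  rewrite (L_eq _ kappa) -?defectE => [|a aS].
    apply: strong => //.
    exact: (finite_support_variation_integrable powerset_T null_mu).
  rewrite KE // (kappaE a _ (ltnSn _)) -(rv (dep a).+1).
  apply/esym.
  exact: (kernel_fibre countable_T powerset_T tree_T markov_p nn_p chain_Z
            irreducible_Z _ retr).
Qed.
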